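(* Let $n\ge 1$ be an integer, let $R$ be a commutative unital integral domain, let $H$ be a Hopf algebra over $R$, and let $\Pi$ be a finite subgroup of weights of $H$. Suppose $h_1,\dots,h_n\in H$ are pseudo-primitive with respect to $\Pi$, with $\Delta(h_i)=g_i\otimes h_i+h_i\otimes g'_i$ for all $i$ (where $g_i,g_i'$ are grouplike with $\gamma(g_i)=\gamma(g_i')$ for all $\gamma\in\Pi$). Put $\mathbf h=\prod_{i=1}^n h_i$ and $\mathbf g=\prod_{i=1}^n g_i$. \begin{enumerate} \item If $\mathrm{char}(R)=0$ or $\mathrm{char}(R)\nmid|\Pi|$, then $\Sigma_\Pi(\mathbf h)=0$. \item Suppose $0<p=\mathrm{char}(R)$ divides $|\Pi|$, and $\Pi_p$ is any $p$-Sylow subgroup of $\Pi$. If $\Pi_p\not\cong(\mathbb Z/p\mathbb Z)^m$ for every $m>0$, then $\Sigma_\Pi(\mathbf h)=0$. \item Let $p=\mathrm{char}(R)>0$ divide $|\Pi|$, let $\Phi:=\Pi/[\Pi,\Pi]$, and suppose that the $p$-Sylow subgroup $\Phi_p$ of $\Phi$ satisfies $\Phi_p\cong(\mathbb Z/p\mathbb Z)^k$. Let $\Phi'$ be a Hall complementary subgroup in $\Phi$, so $|\Phi'|=|\Phi|/|\Phi_p|$. Then $$\Sigma_\Pi(\mathbf h)=|[\Pi,\Pi]|\cdot\Sigma_{\Phi'}(\mathbf g)\cdot\Sigma_{\Phi_p}(\mathbf h).$$ \item With $p,\Phi,\Phi_p,k$ as in (3): if $\Sigma_{\Phi_p}(\mathbf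 h)\ne0$, then $(p-1)\mid n$ and $0\le k\le n/(p-1)$. Moreover, for every commutative unital integral domain $R$ of characteristic $p>0$ and every $r\in R$, there exist examples ($n$, $H$, $\Pi$, $h_1,\dots,h_n$ as in (3)) in which $\Sigma_{\Phi_p}(\mathbf h)=r$. \end{enumerate}
   Context: A weight of an $R$-Hopf algebra $H$ (comultiplication $\Delta$, counit $\varepsilon$, antipode $S$) is an $R$-algebra homomorphism $H\to R$. The set $\Gamma_H$ of weights is a group under convolution $(\lambda*\nu)(h)=(\lambda\otimes\nu)(\Delta(h))$, with identity $\varepsilon$ and inverse $\lambda^{-1}=\lambda\circ S$. For a finite set $\Theta$ of weights, $\Sigma_\Theta:=\sum_{\gamma\in\Theta}\gamma:H\to R$. Integers such as $|[\Pi,\Pi]|$ are viewed in $R$ via $\mathbb Z\to R$. An element $g\in H$ is grouplike if $\Delta(g)=g\otimes g$ and $\varepsilon(g)=1$. An element $h\in H$ is pseudo-primitive with respect to $\Pi$ if $\Delta(h)=g\otimes h+h\otimes g'$ for grouplike $g,g'$ satisfying $\gamma(g)=\gamma(g')$ for all $\gamma\in\Pi$. For a subgroup $\Theta\subset\Phi=\Pi/[\Pi,\Pi]$ and $x\in\{\mathbf g,\mathbf h\}$, $\Sigma_\Theta(x)$ denotes $\sum_{\tilde\gamma\in\widetilde\Theta}\tilde\gamma(x)$, where $\widetilde\Theta\subset\Pi$ is any set containing exactly one lift of each element of $\Theta$; this does not depend on the choice of lifts. *)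

(* Defs.v *)
From HB Require Import structures.
From mathcomp Require Import all_boot all_order all_algebra.
From mathcomp Require Import all_fingroup all_solvable.
From mathcomp Require Import generic_quotient finmap boolp.

Set Implicit Arguments.
Unset Strict Implicit.
Unset Printing Implicit Defensive.

Import GRing.Theory.
Local Open Scope ring_scope.

(* M \otimes_R N is built by generators and relations: formal sums of pure    *)
(* tensors are sequences of pairs, taken modulo the additive congruence       *)
(* generated by bilinearity (commutativity of + is [ot_comm], and             *)
(* [:: (0, y)] ~ [::] provides opposites).                                    *)
Section Tensor.
Variables (R : comNzRingType) (M N : lmodType R).
Implicit Types s t : seq (M * N).

Inductive oteq : seq (M * N) -> seq (M * N) -> Prop :=
| ot_refl s : oteq s s
| ot_sym s t : oteq s t -> oteq t s
| ot_trans s t r : oteq s t -> oteq t r -> oteq s r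
| ot_cat s s' t t' : oteq s s' -> oteq t t' -> oteq (s ++ t) (s' ++ t')
| ot_comm s t : oteq (s ++ t) (t ++ s)
| ot_zero y : oteq [:: (0, y)] [::]
| ot_addl x x' y : oteq [:: (x + x', y)] [:: (x, y); (x', y)]
| ot_addr x y y' : oteq [:: (x, y + y')] [:: (x, y); (x, y')]
| ot_scale a x y : oteq [:: (a *: x, y)] [:: (x, a *: y)].

Definition oteqb : rel (seq (M * N)) := fun s t => `[< oteq s t >].

Lemma oteqb_refl : reflexive oteqb.
Proof. by move=> s; apply/asboolP; exact: ot_refl. Qed.
Lemma oteqb_sym : symmetric oteqb.
Proof. by move=> s t; apply/asboolP/asboolP => /ot_sym. Qed.
Lemma oteqb_trans : transitive oteqb.
Proof.
by move=> s t r /asboolP ts /asboolP sr; apply/asboolP; exact: ot_trans ts sr.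
Qed.

Canonical oteq_equiv := EquivRel oteqb oteqb_refl oteqb_sym oteqb_trans.

Definition tensor : Type := {eq_quot oteq_equiv}%qT.
HB.instance Definition _ := Choice.on tensor.
HB.instance Definition _ := EqQuotient.on tensor.

Definition tclass s : tensor := \pi_tensor%qT s.
Definition pure (x : M) (y : N) : tensor := tclass [:: (x, y)].

Lemma tclassP s t : tclass s = tclass t <-> oteq s t.
Proof.
split=> [/eqP|st]; first by rewrite eqmodE => /asboolP.
by apply/eqP; rewrite eqmodE; apply/asboolP.
Qed.

Lemma tclass_repr (u : tensor) : tclass (repr u) = u.
Proof. exact: reprK. Qed.

Lemma repr_tclass s : oteq (repr (tclass s)) s.
Proof. by apply/tclassP; rewrite tclass_repr. Qed.

Definition tadd (u v : tensor) := tclass (repr u ++ repr v).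
Definition topp (u : tensor) := tclass [seq (- z.1, z.2) | z <- repr u].
Definition tscale (a : R) (u : tensor) :=
  tclass [seq (a *: z.1, z.2) | z <- repr u].

Lemma oteq_scale a s t : oteq s t ->
  oteq [seq (a *: z.1, z.2) | z <- s] [seq (a *: z.1, z.2) | z <- t].
Proof.
elim=> {s t} /=.
- by move=> s; exact: ot_refl.
- by move=> s t _; exact: ot_sym.
- by move=> s t r _ + _; exact: ot_trans.
- by move=> s s' t t' _ IHs _ IHt; rewrite !map_cat; exact: ot_cat.
- by move=> s t; rewrite !map_cat; exact: ot_comm.
- by move=> y; rewrite scaler0; exact: ot_zero.
- by move=> x x' y; rewrite scalerDr; exact: ot_addl.
- by move=> x y y'; exact: ot_addr.
- by move=> b x y; rewrite scalerA mulrC -scalerA; exact: ot_scale.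
Qed.

Lemma tadd_class s t : tadd (tclass s) (tclass t) = tclass (s ++ t).
Proof. by apply/tclassP/ot_cat; exact: repr_tclass. Qed.

Lemma tscale_class a s :
  tscale a (tclass s) = tclass [seq (a *: z.1, z.2) | z <- s].
Proof. by apply/tclassP/oteq_scale; exact: repr_tclass. Qed.

Lemma toppE u : topp u = tscale (-1) u.
Proof. by congr tclass; apply: eq_map => z; rewrite scaleN1r. Qed.

Lemma tclassW (P : tensor -> Prop) : (forall s, P (tclass s)) -> forall u, P u.
Proof. by move=> Ps u; rewrite -(tclass_repr u). Qed.

Lemma taddA : associative tadd.
Proof.
by do 3 elim/tclassW => ?; rewrite !tadd_class catA.
Qed.
Lemma taddC : commutative tadd.
Proof. by do 2 elim/tclassW => ?; rewrite !tadd_class; apply/tclassP/ot_comm. Qed.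
Lemma tadd0 : left_id (tclass [::]) tadd.
Proof. by elim/tclassW => ?; rewrite tadd_class. Qed.

Lemma tscaleDl u a b : tscale (a + b) u = tadd (tscale a u) (tscale b u).
Proof.
elim/tclassW: u => s; rewrite !tscale_class tadd_class; apply/tclassP.
elim: s => [|[x y] s IHs] /=; first exact: ot_refl.
rewrite -cat1s scalerDl.
apply: (@ot_trans _ ([:: (a *: x, y); (b *: x, y)] ++
  ([seq (a *: z.1, z.2) | z <- s] ++ [seq (b *: z.1, z.2) | z <- s]))).
  by apply: ot_cat => //; exact: ot_addl.
apply: (ot_cat (ot_refl [:: (a *: x, y)])).
rewrite -cat1s -[X in oteq _ (_ ++ X)]cat1s !catA.
by apply: ot_cat; [exact: ot_comm | exact: ot_refl].
Qed.

Lemma tscale0 u : tscale 0 u = tclass [::].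
Proof.
elim/tclassW: u => s; rewrite tscale_class; apply/tclassP.
elim: s => [|[x y] s IHs] /=; first exact: ot_refl.
by rewrite scale0r -cat1s -[[::]]cats0; apply: ot_cat => //; exact: ot_zero.
Qed.

Lemma tscaleDr a : {morph tscale a : u v / tadd u v}.
Proof.
by do 2 elim/tclassW => ?; rewrite !(tadd_class, tscale_class) map_cat.
Qed.

Lemma tscaleA a b u : tscale a (tscale b u) = tscale (a * b) u.
Proof.
elim/tclassW: u => s; rewrite !tscale_class -map_comp.
by congr tclass; apply: eq_map => z /=; rewrite scalerA.
Qed.

Lemma tscale1 : left_id 1 tscale.
Proof.
elim/tclassW => s; rewrite tscale_class; congr tclass.
by rewrite -[RHS]map_id; apply: eq_map => -[x y] /=; rewrite scale1r.
Qed.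

Lemma taddN : left_inverse (tclass [::]) topp tadd.
Proof. by move=> u; rewrite toppE -{2}(tscale1 u) -tscaleDl addNr tscale0. Qed.

HB.instance Definition _ :=
  GRing.isZmodule.Build tensor taddA taddC tadd0 taddN.
HB.instance Definition _ :=
  GRing.Zmodule_isLmodule.Build R tensor tscaleA tscale1 tscaleDr
    (fun u a b => tscaleDl u a b).

Lemma pureDl x x' y : pure (x + x') y = pure x y + pure x' y.
Proof. by rewrite [RHS]tadd_class; apply/tclassP/ot_addl. Qed.
Lemma pureDr x y y' : pure x (y + y') = pure x y + pure x y'.
Proof. by rewrite [RHS]tadd_class; apply/tclassP/ot_addr. Qed.
Lemma pureZl a x y : pure (a *: x) y = a *: pure x y.
Proof. by rewrite [RHS]tscale_class. Qed.
Lemma pureZr a x y : pure x (a *: y) = a *: pure x y.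
Proof. by rewrite -pureZl; apply/tclassP/ot_sym/ot_scale. Qed.

Lemma tclassE s : tclass s = \sum_(z <- s) pure z.1 z.2.
Proof.
elim: s => [|[x y] s IHs]; first by rewrite big_nil.
by rewrite big_cons -IHs -cat1s [RHS]tadd_class.
Qed.

Lemma tensor_ind (P : tensor -> Prop) :
    P 0 -> (forall u v, P u -> P v -> P (u + v)) ->
  (forall x y, P (pure x y)) -> forall u, P u.
Proof.
move=> P0 PD Pp; elim/tclassW => s; rewrite tclassE.
by elim/big_ind: _ => // z _; exact: Pp.
Qed.

Lemma tensor_ext (W : zmodType) (F G : tensor -> W) :
    {morph F : u v / u + v} -> {morph G : u v / u + v} ->
  (forall x y, F (pure x y) = G (pure x y)) -> F =1 G.
Proof.
move=> FD GD FG; elim/tensor_ind => // [|u v Fu Fv]; last by rewrite FD GD Fu Fv.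
transitivity (0 : W); [|symmetry].
  by apply: (addrI (F 0)); rewrite -FD !addr0.
by apply: (addrI (G 0)); rewrite -GD !addr0.
Qed.

(* Meaningful only when f is R-bilinear: then [tlift f] is the additive map   *)
(* sending each x \otimes y to f x y.                                         *)
Definition tlift (W : nmodType) (f : M -> N -> W) (u : tensor) : W :=
  \sum_(z <- repr u) f z.1 z.2.

Section Lift.
Variables (W : zmodType) (f : M -> N -> W).

Definition balanced :=
  [/\ forall x x' y, f (x + x') y = f x y + f x' y,
      forall x y y', f x (y + y') = f x y + f x y'
    & forall a x y, f (a *: x) y = f x (a *: y)].

Hypothesis bf : balanced.

Lemma oteq_sum s t : oteq s t ->
  \sum_(z <- s) f z.1 z.2 = \sum_(z <- t) f z.1 z.2.
Proof.
case: bf => fDl fDr fZ; elim=> {s t} //.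
- by move=> s t r _ -> _ ->.
- by move=> s s' t t' _ + _; rewrite !big_cat /= => -> ->.
- by move=> s t; rewrite !big_cat /= addrC.
- move=> y; rewrite big_seq1 big_nil /=.
  by apply: (@addrI _ (f 0 y)); rewrite -fDl !addr0.
- by move=> x x' y; rewrite big_seq1 big_cons big_seq1 fDl.
- by move=> x y y'; rewrite big_seq1 big_cons big_seq1 fDr.
- by move=> a x y; rewrite !big_seq1 fZ.
Qed.

Lemma tlift_class s : tlift f (tclass s) = \sum_(z <- s) f z.1 z.2.
Proof. by apply: oteq_sum; exact: repr_tclass. Qed.

Lemma tlift_pure x y : tlift f (pure x y) = f x y.
Proof. by rewrite tlift_class big_seq1. Qed.

Lemma tlift0 : tlift f 0 = 0.
Proof. by rewrite tlift_class big_nil. Qed.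

Lemma tliftD : {morph tlift f : u v / u + v}.
Proof.
do 2 elim/tclassW => ?.
by rewrite [in LHS]/GRing.add /= tadd_class !tlift_class big_cat.
Qed.

End Lift.

Lemma tliftZ (W : lmodType R) (f : M -> N -> W) : balanced f ->
    (forall a x y, f (a *: x) y = a *: f x y) ->
  forall a u, tlift f (a *: u) = a *: tlift f u.
Proof.
move=> bf fZ a; elim/tclassW => s.
rewrite [in LHS]/GRing.scale /= tscale_class !tlift_class // big_map scaler_sumr.
by apply: eq_bigr => z _; rewrite fZ.
Qed.

End Tensor.

Notation "x \otimes y" := (pure x y)
  (at level 40, left associativity) : ring_scope.

Lemma balanced_tlift (R : comNzRingType) (M N M' N' : lmodType R) (W : zmodType)
    (g : M -> N -> M' -> N' -> W) (v : tensor M' N') :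
    (forall x y, balanced (g x y)) ->
    (forall x' y', balanced (fun x y => g x y x' y')) ->
  balanced (fun x y => tlift (g x y) v).
Proof.
move=> bg bg'; elim/tclassW: v => s.
split=> *; rewrite !tlift_class // -?big_split; apply: eq_bigr => z _ /=;
  by case: (bg' z.1 z.2).
Qed.

Lemma tliftC (R : comNzRingType) (M N M' N' : lmodType R) (W : zmodType)
    (g : M -> N -> M' -> N' -> W) (u : tensor M N) (v : tensor M' N') :
    (forall x y, balanced (g x y)) ->
    (forall x' y', balanced (fun x y => g x y x' y')) ->
  tlift (fun x y => tlift (g x y) v) u =
  tlift (fun x' y' => tlift (fun x y => g x y x' y') u) v.
Proof.
move=> bg bg'.
have b1 := balanced_tlift v bg bg'.
have b2 := @balanced_tlift _ _ _ _ _ _ (fun x' y' x y => g x y x' y') u bg' bg.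
elim/tensor_ind: u b2 => [|u1 u2 IH1 IH2|x y] b2.
- elim/tclassW: v b1 b2 => s b1 b2.
  rewrite (tlift_class b2) (tlift0 b1) big1 // => z _.
  exact: tlift0.
- rewrite (tliftD b1) IH1 ?IH2; try exact: (@balanced_tlift _ _ _ _ _ _ (fun x' y' x y => g x y x' y')).
  elim/tclassW: v {b1 IH1 IH2} b2 => s b2.
  rewrite !tlift_class -?big_split //=; try exact: (@balanced_tlift _ _ _ _ _ _ (fun x' y' x y => g x y x' y')).
  by apply: eq_bigr => z _; rewrite tliftD.
rewrite (tlift_pure b1); congr (tlift _ v).
by apply/funext => x'; apply/funext => y'; rewrite tlift_pure.
Qed.

(* The algebra A \otimes_R B. It may be the zero ring, hence it is not an     *)
(* [algType].                                                                 *)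
Section TensorAlgebra.
Variables (R : comNzRingType) (A B : algType R).
Implicit Types u v w : tensor A B.

Definition tmul u v : tensor A B :=
  tlift (fun a b => tlift (fun a' b' => (a * a') \otimes (b * b')) v) u.

Let mulb (a : A) (b : B) : balanced (fun a' b' => (a * a') \otimes (b * b')).
Proof.
split=> *; first by rewrite mulrDr pureDl.
  by rewrite mulrDr pureDr.
by rewrite -!scalerAr pureZl pureZr.
Qed.

Let mulb' (a' : A) (b' : B) :
  balanced (fun a b => (a * a') \otimes (b * b')).
Proof.
split=> *; first by rewrite mulrDl pureDl.
  by rewrite mulrDl pureDr.
by rewrite -!scalerAl pureZl pureZr.
Qed.

Let mulbb v : balanced
  (fun a b => tlift (fun a' b' => (a * a') \otimes (b * b')) v).
Proof. exact: balanced_tlift. Qed.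

Lemma tmul_pure a b a' b' :
  tmul (a \otimes b) (a' \otimes b') = (a * a') \otimes (b * b').
Proof. by rewrite /tmul (tlift_pure (mulbb _)) (tlift_pure (mulb _ _)). Qed.

Lemma tmulDl : left_distributive tmul +%R.
Proof. by move=> u v w; rewrite /tmul (tliftD (mulbb _)). Qed.

Lemma tmulDr : right_distributive tmul +%R.
Proof.
move=> u v w.
have bu : balanced (fun a' b' =>
    tlift (fun a b => (a * a') \otimes (b * b')) u).
  exact: (@balanced_tlift _ _ _ _ _ _
    (fun a' b' a b => (a * a') \otimes (b * b'))).
have E t : tmul u t = tlift (fun a' b' =>
    tlift (fun a b => (a * a') \otimes (b * b')) u) t by exact: tliftC.
by rewrite !E (tliftD bu).
Qed.

Lemma tmul0l u : tmul 0 u = 0.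
Proof. by apply: (addrI (tmul 0 u)); rewrite -tmulDl !addr0. Qed.
Lemma tmul0r u : tmul u 0 = 0.
Proof. by apply: (addrI (tmul u 0)); rewrite -tmulDr !addr0. Qed.

Lemma tmulA : associative tmul.
Proof.
move=> u v w; elim/tensor_ind: u => [|u u' IH IH'|a b].
- by rewrite !tmul0l.
- by rewrite !tmulDl IH IH'.
elim/tensor_ind: v => [|v v' IH IH'|a' b'].
- by rewrite !(tmul0l, tmul0r).
- by rewrite !(tmulDl, tmulDr) IH IH'.
elim/tensor_ind: w => [|w w' IH IH'|a'' b''].
- by rewrite !tmul0r.
- by rewrite !tmulDr IH IH'.
by rewrite !tmul_pure !mulrA.
Qed.

Lemma tmul1l : left_id (1 \otimes 1) tmul.
Proof.
elim/tensor_ind=> [|u v IHu IHv|a b]; first exact: tmul0r.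
  by rewrite tmulDr IHu IHv.
by rewrite tmul_pure !mul1r.
Qed.

Lemma tmul1r : right_id (1 \otimes 1) tmul.
Proof.
elim/tensor_ind=> [|u v IHu IHv|a b]; first exact: tmul0l.
  by rewrite tmulDl IHu IHv.
by rewrite tmul_pure !mulr1.
Qed.

HB.instance Definition _ := GRing.Zmodule_isPzRing.Build (tensor A B)
  tmulA tmul1l tmul1r tmulDl tmulDr.

Lemma pureM a b a' b' :
  (a \otimes b : tensor A B) * (a' \otimes b') = (a * a') \otimes (b * b').
Proof. exact: tmul_pure. Qed.

End TensorAlgebra.

Definition tmap (R : comNzRingType) (M N M' N' : lmodType R)
    (f : M -> M') (g : N -> N') : tensor M N -> tensor M' N' :=
  tlift (fun x y => f x \otimes g y).

Definition tassoc (R : comNzRingType) (M N P : lmodType R) :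
    tensor (tensor M N) P -> tensor M (tensor N P) :=
  tlift (fun u z => tlift (fun x y => x \otimes (y \otimes z)) u).

HB.mixin Record isHopf (R : comNzRingType) H of GRing.Algebra R H := {
  comul : H -> tensor H H;
  counit : H -> R;
  antipode : H -> H;
  comul_linear : linear comul;
  comul_monoid_morphism : monoid_morphism comul;
  counit_linear : scalar counit;
  counit_monoid_morphism : monoid_morphism counit;
  antipode_linear : linear antipode;
  comulA : forall h : H,
    tassoc (tmap comul idfun (comul h)) = tmap idfun comul (comul h);
  counitl : forall h : H, tlift (fun a b => counit a *: b) (comul h) = h;
  counitr : forall h : H, tlift (fun a b => counit b *: a) (comul h) = h;
  antipodel : forall h : H,
    tlift (fun a b => antipode a * b) (comul h) = (counit h)%:A;
  antipoder : forall h : H,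
    tlift (fun a b => a * antipode b) (comul h) = (counit h)%:A
}.

#[short(type="hopfAlgType")]
HB.structure Definition Hopf (R : comNzRingType) :=
  {H of GRing.Algebra R H & isHopf R H}.

Section HopfTheory.
Variables (R : comNzRingType) (H : hopfAlgType R).
Local Notation Delta := (@comul R H).
Local Notation eps := (@counit R H).
Local Notation S := (@antipode R H).
Implicit Types (x y h : H) (phi psi chi : H -> R).

HB.instance Definition _ := GRing.isLinear.Build R H (tensor H H) *:%R
  Delta (@comul_linear R H).
HB.instance Definition _ := GRing.isMonoidMorphism.Build H (tensor H H)
  Delta (@comul_monoid_morphism R H).
HB.instance Definition _ := GRing.isLinear.Build R H R *%R
  eps (@counit_linear R H).
HB.instance Definition _ := GRing.isMonoidMorphism.Build H R
  eps (@counit_monoid_morphism R H).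
HB.instance Definition _ := GRing.isLinear.Build R H H *:%R
  S (@antipode_linear R H).

Lemma raddf_tlift (M N : lmodType R) (V W : zmodType) (F : {additive V -> W})
    (f : M -> N -> V) u :
  F (tlift f u) = tlift (fun a b => F (f a b)) u.
Proof. exact: raddf_sum. Qed.

Lemma coassoc_tlift (W : zmodType) (T : H -> H -> H -> W) h :
    (forall x, balanced (T x)) -> (forall z, balanced (fun x y => T x y z)) ->
  tlift (fun a b => tlift (fun a1 a2 => T a1 a2 b) (Delta a)) (Delta h) =
  tlift (fun a b => tlift (fun b1 b2 => T a b1 b2) (Delta b)) (Delta h).
Proof.
move=> bl br.
have TDl x x' y z : T (x + x') y z = T x y z + T x' y z by case: (br z).
have TDr x y z z' : T x y (z + z') = T x y z + T x y z' by case: (bl x).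
have TZ a x y z : T (a *: x) y z = T x y (a *: z).
  by case: (br z) => _ _ ->; case: (bl x) => _ _ ->.
have b1 : balanced (fun u z => tlift (fun x y => T x y z) u : W).
  split=> [u u' z|u z z'|a u z]; first by rewrite tliftD.
    elim/tclassW: u => s; rewrite !tlift_class // -big_split.
    by apply: eq_bigr.
  move: u; apply: tensor_ext => [u v|u v|x y]; rewrite ?scalerDr ?tliftD //.
  by rewrite -pureZl !tlift_pure.
have b2 : balanced (fun x u => tlift (T x) u : W).
  split=> [x x' u|x u u'|a x u]; last 1 first.
  - move: u; apply: tensor_ext => [u v|u v|y z]; rewrite ?scalerDr ?tliftD //.
    by rewrite -pureZr !tlift_pure.
  - elim/tclassW: u => s; rewrite !tlift_class // -big_split.
    by apply: eq_bigr.
  by rewrite tliftD.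
pose L : tensor H (tensor H H) -> W := tlift (fun x u => tlift (T x) u).
have b3 (z : H) : balanced (fun x y : H => x \otimes (y \otimes z)).
  by split=> *; rewrite ?pureDl ?pureDr // ?pureZl ?pureZr.
have b4 : balanced (fun (u : tensor H H) (z : H) =>
    tlift (fun x y => x \otimes (y \otimes z)) u).
  split=> [u u' z|u z z'|a u z]; first by rewrite tliftD.
    elim/tclassW: u => s; rewrite !tlift_class // -big_split.
    by apply: eq_bigr => p _; rewrite !pureDr.
  move: u; apply: tensor_ext => [u v|u v|x y]; rewrite ?scalerDr ?tliftD //.
  by rewrite -pureZl !tlift_pure // pureZl !pureZr.
have LE t : L (tassoc t) =
    tlift (fun u z => tlift (fun x y => T x y z) u) t.
  move: t; apply: tensor_ext => [u v|u v|u z].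
  - by rewrite /tassoc /L (tliftD b4) (tliftD b2).
  - by rewrite (tliftD b1).
  rewrite /tassoc (tlift_pure b4) (tlift_pure b1).
  move: u; apply: tensor_ext => [u v|u v|x y].
  - by rewrite (tliftD (b3 z)) /L (tliftD b2).
  - by rewrite tliftD.
  by rewrite (tlift_pure (b3 z)) /L (tlift_pure b2) !tlift_pure.
have b5 : balanced (fun x y : H => Delta x \otimes y).
  split=> [u v w|u v w|a u v].
  - by rewrite linearD pureDl.
  - by rewrite pureDr.
  by rewrite linearZ /= pureZl pureZr.
have b6 : balanced (fun x y : H => x \otimes Delta y).
  split=> [u v w|u v w|a u v].
  - by rewrite pureDl.
  - by rewrite linearD pureDr.
  by rewrite linearZ /= pureZl pureZr.
have b7 : balanced (fun a b => tlift (fun a1 a2 => T a1 a2 b) (Delta a)).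
  case: b1 => B1 B2 B3; split=> [u v w|u v w|a u v].
  - by rewrite linearD B1.
  - by rewrite B2.
  by rewrite linearZ /= B3.
have b8 : balanced (fun a b => tlift (T a) (Delta b)).
  case: b2 => B1 B2 B3; split=> [u v w|u v w|a u v].
  - by rewrite B1.
  - by rewrite linearD B2.
  by rewrite linearZ /= B3.
have := congr1 L (comulA h); rewrite LE => E.
transitivity (tlift (fun u z => tlift (fun x y => T x y z) u)
                    (tmap Delta idfun (Delta h))).
  move: (Delta h); apply: tensor_ext => [u v|u v|x y].
  - by rewrite (tliftD b7).
  - by rewrite /tmap (tliftD b5) (tliftD b1).
  by rewrite (tlift_pure b7) /tmap (tlift_pure b5) (tlift_pure b1).
rewrite E; move: (Delta h); apply: tensor_ext => [u v|u v|x y].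
- by rewrite /tmap /L (tliftD b6) (tliftD b2).
- by rewrite (tliftD b8).
by rewrite (tlift_pure b8) /tmap (tlift_pure b6) /L (tlift_pure b2).
Qed.

Definition conv phi psi h : R := tlift (fun a b => phi a * psi b) (Delta h).

Lemma balanced_conv phi psi : scalar phi -> scalar psi ->
  balanced (fun a b => phi a * psi b).
Proof.
move=> lphi lpsi.
have phiD : {morph phi : u v / u + v}.
  by move=> u v; rewrite -[u]scale1r lphi mul1r scale1r.
have psiD : {morph psi : u v / u + v}.
  by move=> u v; rewrite -[u]scale1r lpsi mul1r scale1r.
have phiZ := scalable_linear lphi; have psiZ := scalable_linear lpsi.
split=> *; first by rewrite phiD mulrDl.
  by rewrite psiD mulrDr.
by rewrite phiZ psiZ mulrCA mulrA.
Qed.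

Lemma scalar_conv phi psi : scalar phi -> scalar psi -> scalar (conv phi psi).
Proof.
move=> lphi lpsi a u v; have b := balanced_conv lphi lpsi.
rewrite /conv linearP (tliftD b); congr (_ + _).
apply: (tliftZ (W := R^o) b) => c x y.
by rewrite (scalable_linear lphi) -mulrA.
Qed.

Lemma convA phi psi chi : scalar phi -> scalar psi -> scalar chi ->
  conv phi (conv psi chi) = conv (conv phi psi) chi.
Proof.
move=> lphi lpsi lchi; apply/funext => h.
transitivity (tlift (fun a b =>
    tlift (fun b1 b2 => phi a * psi b1 * chi b2) (Delta b)) (Delta h)).
  apply: eq_bigr => z _; rewrite mulr_sumr; apply: eq_bigr => w _.
  by rewrite mulrA.
rewrite -(@coassoc_tlift _ (fun a b c => phi a * psi b * chi c)).
- by apply: eq_bigr => z _; rewrite mulr_suml.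
- move=> x; have [B1 B2 B3] := balanced_conv lpsi lchi.
  by split=> *; rewrite -!mulrA ?B1 ?B2 ?B3 ?mulrDr.
move=> z; have [B1 B2 B3] := balanced_conv lphi lpsi.
by split=> *; rewrite ?B1 ?B2 ?B3 ?mulrDl.
Qed.

Lemma scalar_tlift (M N : lmodType R) phi (f : M -> N -> H) u : scalar phi ->
  phi (tlift f u) = tlift (fun a b => phi (f a b)) u.
Proof.
move=> lphi.
pose F : {scalar H} := HB.pack phi (GRing.isLinear.Build _ _ _ _ phi lphi).
exact: (raddf_tlift F).
Qed.

Lemma conv_eps phi : scalar phi -> conv phi eps = phi.
Proof.
move=> lphi; apply/funext => h; rewrite -[in RHS](counitr h) scalar_tlift //.
by apply: eq_bigr => z _; rewrite /= (scalable_linear lphi) mulrC.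
Qed.

Lemma eps_conv phi : scalar phi -> conv eps phi = phi.
Proof.
move=> lphi; apply/funext => h; rewrite -[in RHS](counitl h) scalar_tlift //.
by apply: eq_bigr => z _; rewrite /= (scalable_linear lphi).
Qed.

Lemma tlift_mul (W : zmodType) (B : H -> H -> W) (u v : tensor H H) :
    balanced B ->
  tlift B (u * v) =
  tlift (fun c d => tlift (fun a b => B (a * c) (b * d)) u) v.
Proof.
move=> bB; case: (bB) => B1 B2 B3.
have b1 a b : balanced (fun c d => B (a * c) (b * d)).
  by split=> *; rewrite ?mulrDr -?scalerAr ?B1 ?B2 ?B3.
have b2 c d : balanced (fun a b => B (a * c) (b * d)).
  by split=> *; rewrite ?mulrDl -?scalerAl ?B1 ?B2 ?B3.
have b3 := @balanced_tlift _ _ _ _ _ _ (fun c d a b => B (a * c) (b * d)) u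
  b2 b1.
move: v b3; move: u => u v b3.
move: v; apply: tensor_ext => [v w|v w|c d].
- by rewrite mulrDr tliftD.
- by rewrite (tliftD b3).
rewrite (tlift_pure b3); move: {b3} u; apply: tensor_ext => [v w|v w|a b].
- by rewrite mulrDl tliftD.
- by rewrite tliftD.
by rewrite pureM !tlift_pure.
Qed.

Definition weight : Type := {lrmorphism H -> R | *%R}.

End HopfTheory.

Section Weights.
Variables (R : comNzRingType) (H : hopfAlgType R).
Local Notation Delta := (@comul R H).
Local Notation eps := (@counit R H).
Local Notation S := (@antipode R H).
Implicit Types (x y h : H) (la nu mu : weight H).

Lemma weightP la nu : la =1 nu -> la = nu.
Proof.
case: la => f [[[f0 fD]] [[f1 fM]] [fZ]].
case: nu => g [[[g0 gD]] [[g1 gM]] [gZ]] /= /funext fg.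
case: _ / fg g0 gD g1 gM gZ => g0 gD g1 gM gZ.
rewrite (Prop_irrelevance f0 g0) (Prop_irrelevance fD gD).
rewrite (Prop_irrelevance f1 g1) (Prop_irrelevance fM gM).
by rewrite (Prop_irrelevance fZ gZ).
Qed.

Lemma weight_scalar la : scalar la.
Proof. by move=> a x y; rewrite linearP. Qed.
#[local] Hint Resolve weight_scalar : core.

Lemma conv_monoid_morphism la nu : monoid_morphism (conv la nu).
Proof.
have b := balanced_conv (weight_scalar la) (weight_scalar nu).
split=> [|x y]; rewrite /conv.
  by rewrite rmorph1 (tlift_pure b) !rmorph1 mulr1.
rewrite rmorphM (tlift_mul _ _ b) [RHS]mulr_sumr.
apply: eq_bigr => w _; rewrite mulr_suml; apply: eq_bigr => z _.
by rewrite !rmorphM /= mulrACA.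
Qed.

HB.instance Definition _ la nu := GRing.isLinear.Build R H R *%R
  (conv la nu) (scalar_conv (weight_scalar la) (weight_scalar nu)).
HB.instance Definition _ la nu := GRing.isMonoidMorphism.Build H R
  (conv la nu) (conv_monoid_morphism la nu).

Definition comp_antipode la h : R := la (S h).

Lemma scalar_comp_antipode la : scalar (comp_antipode la).
Proof. by move=> a x y; rewrite /comp_antipode !linearP. Qed.

Lemma conv_antipodel la : conv (comp_antipode la) la = eps.
Proof.
apply/funext => h; have := congr1 la (antipodel h).
rewrite (scalar_tlift _ _ (weight_scalar la)) linearZ /= rmorph1 mulr1 => <-.
by apply: eq_bigr => z _; rewrite /= rmorphM.
Qed.

Lemma conv_antipoder la : conv la (comp_antipode la) = eps.
Proof.
apply/funext => h; have := congr1 la (antipoder h).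
rewrite (scalar_tlift _ _ (weight_scalar la)) linearZ /= rmorph1 mulr1 => <-.
by apply: eq_bigr => z _; rewrite /= rmorphM.
Qed.

Lemma comp_antipode_monoid_morphism la : monoid_morphism (comp_antipode la).
Proof.
set f := comp_antipode la; have lf : scalar f := scalar_comp_antipode la.
have leps : scalar eps := @counit_linear R H.
split=> [|x y].
  have := congr1 (fun g => g 1) (conv_antipodel la).
  rewrite /= /conv rmorph1 (tlift_pure (balanced_conv lf (weight_scalar la))).
  by rewrite !rmorph1 mulr1.
have lfl c : scalar (fun a => f (a * c)).
  by move=> a u v; rewrite mulrDl -scalerAl lf.
have lfr c : scalar (fun a => f (c * a)).
  by move=> a u v; rewrite mulrDr -scalerAr lf.
pose G a c := conv (fun b => f (b * c)) la a.
have lG a : scalar (G a).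
  move=> k u v; rewrite /G /conv mulr_sumr -big_split.
  by apply: eq_bigr => z _; rewrite /= mulrDr -scalerAr lf mulrDl mulrA.
have GE a c : conv (G a) la c = eps a * eps c.
  have b := balanced_conv lf (weight_scalar la).
  transitivity (eps (a * c)); last exact: rmorphM.
  rewrite -(conv_antipodel la) /conv rmorphM (tlift_mul _ _ b).
  apply: eq_bigr => w _; rewrite mulr_suml; apply: eq_bigr => z _.
  by rewrite rmorphM -mulrA.
have Gf a c : G a c = eps a * f c.
  transitivity (conv (conv (G a) la) f c).
    by rewrite -convA // conv_antipoder conv_eps.
  rewrite (funext (GE a)) -[f in RHS]eps_conv // /conv mulr_sumr.
  by apply: eq_bigr => z _ /=; rewrite mulrA.
transitivity (conv (conv (fun b => f (b * y)) la) f x).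
  by rewrite -convA // conv_antipoder conv_eps.
have -> : conv (fun b => f (b * y)) la = fun a => eps a * f y.
  by apply/funext => a; exact: Gf.
rewrite -[f in f x * _]eps_conv // /conv mulr_suml.
by apply: eq_bigr => z _ /=; rewrite mulrAC.
Qed.

HB.instance Definition _ la := GRing.isLinear.Build R H R *%R
  (comp_antipode la) (scalar_comp_antipode la).
HB.instance Definition _ la := GRing.isMonoidMorphism.Build H R
  (comp_antipode la) (comp_antipode_monoid_morphism la).

HB.instance Definition _ := gen_eqMixin (weight H).
HB.instance Definition _ := gen_choiceMixin (weight H).

Definition wone : weight H := (eps : {lrmorphism H -> R | *%R}).
Definition wmul la nu : weight H := (conv la nu : {lrmorphism H -> R | *%R}).
Definition winv la : weight H := (comp_antipode la : {lrmorphism H -> R | *%R}).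

Lemma wmulA : associative wmul.
Proof.
by move=> la nu mu; apply: weightP => h; rewrite /= convA.
Qed.

Lemma wmul1l : left_id wone wmul.
Proof. by move=> la; apply: weightP => h; rewrite /= eps_conv. Qed.

Lemma wmul1r : right_id wone wmul.
Proof. by move=> la; apply: weightP => h; rewrite /= conv_eps. Qed.

Lemma wmulV : left_inverse wone winv wmul.
Proof. by move=> la; apply: weightP => h; rewrite /= conv_antipodel. Qed.

Lemma wmulVr : right_inverse wone winv wmul.
Proof. by move=> la; apply: weightP => h; rewrite /= conv_antipoder. Qed.

HB.instance Definition _ := isGroup.Build (weight H)
  wmulA wmul1l wmul1r wmulV wmulVr.

End Weights.

Record finSubgroup (G : groupType) := FinSubgroup {
  finSubgroup_set :> {fset G};
  finSubgroup_closed : group_closed (mem finSubgroup_set)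
}.

Definition finSubgroup_elt (G : groupType) (P : finSubgroup G) : Type :=
  fset_sub_type P.

HB.instance Definition _ (G : groupType) (P : finSubgroup G) :=
  SubFinite.on (finSubgroup_elt P).
HB.instance Definition _ (G : groupType) (P : finSubgroup G) :=
  SubChoice_isSubGroup.Build _ _ (finSubgroup_elt P) (finSubgroup_closed P).

Section PseudoPrimitive.
Variables (R : comNzRingType) (H : hopfAlgType R) (Pi : finSubgroup (weight H)).

Definition grouplike (g : H) : Prop := comul g = g \otimes g /\ counit g = 1.

(* h is pseudo-primitive with respect to Pi, as witnessed by g and g'.        *)
Definition pseudo_primitive (g h g' : H) : Prop :=
  [/\ grouplike g, grouplike g',
      forall gamma : weight H,
        gamma \in finSubgroup_set Pi -> gamma g = gamma g'
    & comul h = g \otimes h + h \otimes g'].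

Definition derived : {group finSubgroup_elt Pi} :=
  [~: [set: finSubgroup_elt Pi], [set: finSubgroup_elt Pi]]%G.

Definition abelianization : {group coset_of derived} :=
  ([set: finSubgroup_elt Pi] / derived)%G.

Definition weight_sum (T : {set finSubgroup_elt Pi}) (x : H) : R :=
  \sum_(gamma in T) (val gamma : weight H) x.

(* T contains exactly one lift of each element of Theta; [coset derived] is   *)
(* the projection onto the abelianization, defined on the whole group because *)
(* the derived subgroup is normal.                                            *)
Definition is_lift (Theta : {set coset_of derived})
    (T : {set finSubgroup_elt Pi}) : Prop :=
  {in T &, injective (coset derived)} /\ coset derived @: T = Theta.

End PseudoPrimitive.

(* Main.v *)
Require Import Defs.
From HB Require Import structures.
From mathcomp Require Import all_boot all_order all_algebra.
From mathcomp Require Import all_fingroup all_solvable.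
From mathcomp Require Import finfield mxabelem boolp finmap.

(* For gamma in Pi, gamma(h_i) = gamma(g_i) f_i(gamma), where f_i is          *)
(* a homomorphism from Pi to the additive group of R; hence gamma |->         *)
(* gamma(hh) is a multiplicative character u times a product of additive      *)
(* characters f_i. The f_i kill elements of order invertible in R, and u      *)
(* kills p-elements when R has characteristic p.                              *)
(* (2) If the p-Sylow subgroup is not elementary abelian, some z != 1 in it   *)
(* is killed by u and all f_i, so the sum is constant along the cosets of     *)
(* <z>, whose order vanishes in R.                                            *)
(* (3) Each element of Pi is uniquely d b a with d in [Pi, Pi] and a, b lifts *)
(* of elements of Phi_p and Phi'; there the summand is u(b) times its value   *)
(* at a.                                                                      *)
(* (4) On (Z/p)^k the summand is a homogeneous polynomial of degree n, and    *)
(* the sum over F_p^k of a monomial vanishes unless all its exponents are     *)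
(* positive multiples of p - 1. For the example, take the Hopf algebra of     *)
(* R-valued functions on Z/p: its evaluations form a group of weights, and    *)
(* x |-> x is primitive. The sum of x^(p-1) over F_p is -1.                   *)

(** Applying gamma * nu to h through Delta(h) = g (x) h + h (x) g', and using nu(g') = nu(g), gives
    (gamma * nu)(h) = gamma(g) nu(h) + gamma(h) nu(g). Division by (gamma * nu)(g) shows that
    gamma(h) / gamma(g) is additive in gamma ([ev_pseudo_primitive]). What remains concerns a finite
    group with one multiplicative and n additive characters in a domain: [charprod_sum_pchar'] is
    (1), where every term is zero, [charprod_sum_Sylow] is (2), [charprod_sum_split] is (3), and
    [charprod_sum_abelem] reduces the bound in (4) to [sum_prod_additive_rV_neq0]. *)

Set Implicit Arguments.
Unset Strict Implicit.
Unset Printing Implicit Defensive.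

Import GRing.Theory.
Local Open Scope ring_scope.

(* Opaque, so that [/=] leaves the morphism folded.                           *)
Lemma Fp_morph (p : nat) (R : nzRingType) :
  p \in [pchar R] -> {rmorphism 'F_p -> R}.
Proof.
by move=> pR; exact: (in_alg (pPrimeCharType pR) :
  {rmorphism 'F_p -> pPrimeCharType pR}).
Qed.

Lemma expFp_p1 p (t : 'F_p) : prime p -> t != 0 -> t ^+ (p - 1) = 1.
Proof.
move=> p_pr t0; apply: (mulfI t0).
rewrite mulr1 -exprS subn1 prednK ?prime_gt0 //.
by have := expf_card t; rewrite card_Fp.
Qed.

(** * Power sums over the prime field *)

Section PowerSums.
Variables (p : nat) (R : idomainType).
Hypothesis pR : p \in [pchar R].
Variable phi : {rmorphism 'F_p -> R}.
Let p_pr := pcharf_prime pR.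

(** For k = 0 the sum is p, which is 0 in R. In general, substituting c * t for t, with c a
    primitive (p - 1)-th root of unity, multiplies the sum by phi c ^+ k; a nonzero sum forces c ^+
    k = 1. *)
Lemma sum_powers_Fp_neq0 k : \sum_(t : 'F_p) phi t ^+ k != 0 ->
  (0 < k)%N /\ (p - 1 %| k)%N.
Proof.
move=> S0; split.
  rewrite lt0n; apply: contraNneq S0 => ->.
  by rewrite sumr_const card_Fp // pcharf0.
have p1_gt0 : (0 < p - 1)%N by rewrite subn_gt0 prime_gt1.
pose rs := enum (predC1 (0 : 'F_p)).
have /(has_prim_root p1_gt0) : all (p - 1).-unity_root rs.
  apply/allP => t; rewrite mem_enum !inE unity_rootE => t0.
  by rewrite expFp_p1.
rewrite enum_uniq => /(_ isT).
rewrite -cardE cardC1 card_Fp // subn1 leqnn => /(_ isT)/hasP[c _ prc].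
have c0 : c != 0.
  apply/eqP => c0; have /eqP := prim_expr_order prc.
  by rewrite c0 expr0n -subn1 eqn0Ngt p1_gt0 /= eq_sym oner_eq0.
rewrite (prim_order_dvd prc) -(inj_eq (fmorph_inj phi)) rmorphXn rmorph1.
apply/eqP; apply: (mulIf S0); rewrite mul1r mulr_sumr.
rewrite [RHS](reindex_inj (mulfI c0)); apply: eq_bigr => t _.
by rewrite rmorphM exprMn.
Qed.

(* Expanding the product over the standard coordinates turns the sum into a   *)
(* combination of products of [k] power sums over 'F_p, whose exponents add   *)
(* up to [n].                                                                 *)
Lemma sum_prod_additive_rV_neq0 (k n : nat) (f : 'I_n -> 'rV['F_p]_k -> R) :
    (forall i, {morph f i : x y / x + y}) ->
    \sum_(v : 'rV['F_p]_k) \prod_(i < n) f i v != 0 ->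
  (p - 1 %| n)%N /\ (k <= n %/ (p - 1))%N.
Proof.
move=> fD S0; have p1_gt0 : (0 < p - 1)%N by rewrite subn_gt0 prime_gt1.
have f0 i : f i 0 = 0 by apply: (addrI (f i 0)); rewrite -fD !addr0.
have fMn i v m : f i (v *+ m) = f i v *+ m.
  by elim: m => [|m IH]; rewrite ?f0 // !mulrS fD IH.
(* Scalars of the prime field are multiples of 1, so additivity already gives linearity. *)
have fZ i (t : 'F_p) v : f i (t *: v) = phi t * f i v.
  by rewrite -[t]natr_Zp scaler_nat fMn rmorph_nat mulr_natl.
have fE i v : f i v = \sum_(j < k) phi (v 0 j) * f i (delta_mx 0 j).
  rewrite {1}[v]row_sum_delta (big_morph (f i) (fD i) (f0 i)).
  by apply: eq_bigr => j _; rewrite fZ.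
(* Expanding the product amounts to choosing a coordinate [s i] for each factor i; [cnt s j] is the
   exponent of coordinate j in the resulting monomial. *)
pose cnt (s : {ffun 'I_n -> 'I_k}) j := #|[set i | s i == j]|.
have [s ps] : exists s, \prod_(j < k) \sum_(t : 'F_p) phi t ^+ cnt s j != 0.
  apply: contrapT => ns; case/eqP: S0.
  transitivity (\sum_(v : 'rV['F_p]_k) \sum_(s : {ffun 'I_n -> 'I_k})
      (\prod_(j < k) phi (v 0 j) ^+ cnt s j) *
      \prod_(i < n) f i (delta_mx 0 (s i))).
    apply: eq_bigr => v _; under eq_bigr do rewrite fE.
    rewrite bigA_distr_bigA; apply: eq_bigr => s _ /=.
    rewrite big_split /=; congr (_ * _).
    rewrite (partition_big s predT) //=; apply: eq_bigr => j _.
    rewrite (eq_bigr (fun=> phi (v 0 j))) => [|i /eqP -> //].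
    by rewrite prodr_const; congr (_ ^+ _); apply: eq_card => i; rewrite !inE.
  rewrite exchange_big big1 //= => s _; rewrite -mulr_suml.
  rewrite [X in X * _](_ : _ = 0) ?mul0r //.
  transitivity (\prod_(j < k) \sum_(t : 'F_p) phi t ^+ cnt s j); last first.
    by apply/eqP/negPn/negP => ps; apply: ns; exists s.
  rewrite bigA_distr_bigA /=.
  pose g (w : {ffun 'I_k -> 'F_p}) : 'rV['F_p]_k := \row_j w j.
  rewrite (reindex g); last first.
    exists (fun v : 'rV['F_p]_k => [ffun j => v 0 j]) => [w _|v _].
      by apply/ffunP => j; rewrite ffunE mxE.
    by apply/rowP => j; rewrite mxE ffunE.
  by apply: eq_bigr => w _; apply: eq_bigr => j _; rewrite mxE.
have cntP j : (0 < cnt s j)%N /\ (p - 1 %| cnt s j)%N.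
  apply: sum_powers_Fp_neq0.
  by move: ps; rewrite (bigD1 j) //= mulf_eq0 negb_or => /andP[].
have nE : n = \sum_(j < k) cnt s j.
  rewrite -[LHS]card_ord -sum1_card (partition_big s predT) //=.
  apply: eq_bigr => j _; rewrite sum1_card.
  by apply: eq_card => i; rewrite !inE.
split; first by rewrite nE; apply: dvdn_sum => j _; case: (cntP j).
rewrite leq_divRL // nE -[X in (X * _)%N]card_ord -sum_nat_const.
by apply: leq_sum => j _; have [c0 /dvdn_leq->] := cntP j.
Qed.

End PowerSums.

(** * Additive and multiplicative characters of a finite group with values in a domain *)

Section AdditiveCharacter.
Variables (gT : finGroupType) (R : idomainType) (f : gT -> R).
Hypothesis fM : {morph f : x y / (x * y)%g >-> x + y}.

Lemma addchar1 : f 1%g = 0.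
Proof. by apply: (addrI (f 1%g)); rewrite -fM mulg1 addr0. Qed.

Lemma addcharV x : f (x^-1)%g = - f x.
Proof. by apply: (addrI (f x)); rewrite -fM mulgV addchar1 subrr. Qed.

Lemma addcharX x k : f (x ^+ k)%g = f x *+ k.
Proof. by elim: k => [|k IH]; rewrite ?addchar1 // expgS fM IH mulrS. Qed.

Lemma addcharR x y : f [~ x, y]%g = 0.
Proof. by rewrite commgEl conjgE !fM !addcharV [f x + _]addrC addKr addNr. Qed.

Lemma addchar_eq0 x k : f (x ^+ k)%g = 0 -> k%:R != 0 :> R -> f x = 0.
Proof.
rewrite addcharX -[f x *+ k]mulr_natr => /eqP; rewrite mulf_eq0 => fk0 k0.
by apply/eqP; rewrite (negPf k0) orbF in fk0.
Qed.

Lemma addchar_der1 x : x \in [~: [set: gT], [set: gT]]%g -> f x = 0.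
Proof.
have gf : group_set [set y | f y == 0].
  apply/group_setP; split=> [|y z]; rewrite !inE ?addchar1 // fM.
  by move=> /eqP -> /eqP ->; rewrite addr0.
suff: [~: [set: gT], [set: gT]]%g \subset Group gf.
  by move=> /subsetP s /s; rewrite inE => /eqP.
rewrite gen_subG; apply/subsetP => _ /imset2P[y z _ _ ->].
by rewrite inE addcharR.
Qed.

End AdditiveCharacter.

Section MultiplicativeCharacter.
Variables (gT : finGroupType) (R : idomainType) (u : gT -> R).
Hypotheses (u1 : u 1%g = 1) (uM : {morph u : x y / (x * y)%g >-> x * y}).

Lemma mulcharV x : u x * u (x^-1)%g = 1.
Proof. by rewrite -uM mulgV. Qed.

Lemma mulcharX x k : u (x ^+ k)%g = u x ^+ k.
Proof. by elim: k => [|k IH]; rewrite ?u1 // expgS uM IH exprS. Qed.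

Lemma mulchar_der1 x : x \in [~: [set: gT], [set: gT]]%g -> u x = 1.
Proof.
have gu : group_set [set y | u y == 1].
  apply/group_setP; split=> [|y z]; rewrite !inE ?u1 // uM.
  by move=> /eqP -> /eqP ->; rewrite mulr1.
suff: [~: [set: gT], [set: gT]]%g \subset Group gu.
  by move=> /subsetP s /s; rewrite inE => /eqP.
rewrite gen_subG; apply/subsetP => _ /imset2P[y z _ _ ->].
rewrite inE commgEl conjgE !uM [u y * _]mulrC [_ * (u z * _)]mulrA.
by rewrite -(uM z^-1 z)%g mulVg u1 mul1r -uM mulVg u1.
Qed.

(** A domain of characteristic p has no p-th root of unity but 1: v ^+ p = 1 gives (v - 1) ^+ p = 0
    by Frobenius. *)
Lemma mulchar_pchar p x k :
  p \in [pchar R] -> u (x ^+ (p ^ k))%g = 1 -> u x = 1.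
Proof.
move=> pR; rewrite mulcharX; elim: k => [|k IH]; first by rewrite expr1.
rewrite expnSr exprM => /eqP; set v := _ ^+ (p ^ k) in IH * => /eqP vp.
apply: IH; apply/eqP; rewrite -subr_eq0; apply: (contraTT (expf_neq0 p)).
rewrite -(pFrobenius_autE pR) (pFrobenius_autB_comm pR (mulrC _ _)).
by rewrite !pFrobenius_autE expr1n vp subrr eqxx.
Qed.

End MultiplicativeCharacter.

(** * Sums of a multiplicative character times additive characters *)

Section CharacterProduct.
Variables (gT : finGroupType) (R : idomainType) (n : nat).
Variables (u : gT -> R) (f : 'I_n -> gT -> R).
Hypotheses (u1 : u 1%g = 1) (uM : {morph u : x y / (x * y)%g >-> x * y}).
Hypothesis fM : forall i, {morph f i : x y / (x * y)%g >-> x + y}.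
Hypothesis n_gt0 : (0 < n)%N.

Let F x := u x * \prod_(i < n) f i x.

(** Each term vanishes: the group order annihilates the values of [f i] and is nonzero in R, and n >
    0 supplies a factor. *)
Lemma charprod_sum_pchar' (A : {set gT}) :
  #|[set: gT]|%:R != 0 :> R -> \sum_(x in A) F x = 0.
Proof.
move=> o0; apply: big1 => x _; rewrite /F (bigD1 (Ordinal n_gt0)) //=.
rewrite [f _ x](_ : _ = 0) ?mul0r ?mulr0 //.
apply: (addchar_eq0 (fM _) (k := #|[set: gT]|)) => //.
by rewrite expg_cardG ?inE // (addchar1 (fM _)).
Qed.

(** G is constant on each right coset of the cycle of z, whose cardinality is 0 in R. *)
Lemma sum_cycle_invariant (G : gT -> R) z p :
    p \in [pchar R] -> (p %| #[z]%g)%N -> (forall x, G (z * x)%g = G x) ->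
  \sum_(x in [set: gT]) G x = 0.
Proof.
move=> pR pz Gz; have s : <[z]>%g \subset [set: gT] by apply: subsetT.
rewrite (set_partition_big _ (rcosets_partition s)) /=.
apply: big1 => _ /rcosetsP[y _ ->].
transitivity (\sum_(x in (<[z]> :* y)%g) G y).
  apply: eq_bigr => x /rcosetP[_ /cycleP[k ->] ->].
  by elim: k => [|k IH]; rewrite ?mul1g // expgS -mulgA Gz.
rewrite sumr_const card_rcoset -mulr_natr.
by rewrite (eqP (_ : #|<[z]>%g|%:R == 0 :> R)) ?mulr0 // -(dvdn_pcharf pR).
Qed.

(** Every [f i] kills commutators and, in characteristic p, p-th powers. If 1 were the only common
    zero of the [f i] in P, then P would be elementary abelian, of positive rank because p divides
    the group order. A common zero z != 1 is a p-element, so u z = 1 and translation by z preserves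
    the summand. *)
Lemma charprod_sum_Sylow p (P : {group gT}) :
    p \in [pchar R] -> (p %| #|[set: gT]|)%N -> (p.-Sylow([set: gT]) P)%g ->
    (forall m, (0 < m)%N -> ~~ (P \isog [set: 'rV['F_p]_m])%g) ->
  \sum_(x in [set: gT]) F x = 0.
Proof.
move=> pR pG sylP nab; have pr := pcharf_prime pR.
have pP : (p.-group P)%g := pHall_pgroup sylP.
have [z zP [z1 fz]] : exists2 z, z \in P & z != 1%g /\ forall i, f i z = 0.
  apply: contrapT => nz.
  have kerP x : x \in P -> (forall i, f i x = 0) -> x = 1%g.
    move=> xP fx; apply/eqP/negPn/negP => x1.
    by apply: nz; exists x.
  have abP : (p.-abelem P)%g.
    apply/abelemP => //; split=> [|x xP].
      apply/centsP => x xP y yP; apply/commgP/eqP/kerP; first exact: groupR.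
      by move=> i; rewrite addcharR.
    apply: kerP => [|i]; first exact: groupX.
    by rewrite addcharX // -mulr_natr pcharf0 // mulr0.
  have oP : #|P| = (p ^ logn p #|P|)%N by rewrite -card_pgroup.
  have P0 : (0 < logn p #|P|)%N.
    by rewrite (card_Hall sylP) logn_part logn_gt0 mem_primes pr cardG_gt0.
  have := nab _ P0; rewrite (isog_abelem_card _ abP) mx_Fp_abelem //=.
  by rewrite cardsT card_mx card_Fp // mul1n -oP eqxx.
have z_p : (p.-elt z)%g := mem_p_elt pP zP.
have [k ok] := p_natP z_p; apply: (sum_cycle_invariant (z := z) pR).
  have z1' : <[z]>%G != 1%g :> {set gT} by rewrite cycle_eq1.
  by have [_ ? _] := pgroup_pdiv (G := <[z]>%G) z_p z1'.
move=> x; rewrite /F uM (mulchar_pchar (k := k) u1 uM pR (x := z)).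
  by rewrite mul1r; congr (_ * _); apply: eq_bigr => i _; rewrite fM fz add0r.
by rewrite -ok expg_order.
Qed.

Lemma charprod_sum_split p
    (Phi_p Phi' : {group coset_of [~: [set: gT], [set: gT]]})
    (T_p T' : {set gT}) :
    let D := [~: [set: gT], [set: gT]]%G in
    let Phi := ([set: gT] / D)%G in
    p \in [pchar R] -> (p.-Sylow(Phi) Phi_p)%g -> (p^'.-Hall(Phi) Phi')%g ->
    {in T_p &, injective (coset D)} -> coset D @: T_p = Phi_p ->
    {in T' &, injective (coset D)} -> coset D @: T' = Phi' ->
  \sum_(x in [set: gT]) F x =
    #|D|%:R * (\sum_(x in T') u x) * (\sum_(x in T_p) F x).
Proof.
move=> D Phi pR sylP hallP' injp imp inj' im'.
have nD x : x \in 'N(D)%g.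
  by apply: (subsetP (der_norm 1 [set: gT])); rewrite inE.
have cosM x y : coset D (x * y)%g = (coset D x * coset D y)%g.
  by rewrite morphM.
have TI : (Phi' :&: Phi_p = 1)%g.
  apply: coprime_TIg; rewrite coprime_sym (card_Hall sylP) (card_Hall hallP').
  exact: coprime_partC.
have PhiE : (Phi' * Phi_p = Phi)%g.
  apply/eqP; rewrite eqEcard mul_subG ?(pHall_sub sylP) ?(pHall_sub hallP') //=.
  rewrite TI_cardMg // (card_Hall sylP) (card_Hall hallP') mulnC.
  by rewrite partnC ?cardG_gt0.
(* b ^+ #|Phi'| lies in D, where [f i] vanishes, and #|Phi'| is prime to p. *)
have fT' i b : b \in T' -> f i b = 0.
  move=> bT; apply: (addchar_eq0 (fM i) (k := #|Phi'|)); last first.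
    rewrite -(dvdn_pcharf pR) -prime_coprime ?(pcharf_prime pR) //.
    rewrite (card_Hall hallP').
    by rewrite (pnat_coprime (pnat_id (pcharf_prime pR))) ?part_pnat.
  apply: (addchar_der1 (fM i)); apply: (coset_idr (H := D)) => //.
  by rewrite morphX //= expg_cardG // -im' imset_f.
(* The factorization x = d * (b * a), with d in D, b in T' and a in T_p, is unique because Phi is
   the product of Phi' and Phi_p, which meet trivially. *)
pose m (t : gT * (gT * gT)) := (t.1 * (t.2.1 * t.2.2))%g.
have m_inj : {in setX D (setX T' T_p) &, injective m}.
  move=> [d [b a]] [d' [b' a']]; rewrite !inE /= /m /=.
  case/and3P=> dD bT aT /and3P[d'D b'T a'T] E.
  have := congr1 (coset D) E.
  rewrite (coset_kerl _ dD) (coset_kerl _ d'D) !cosM => E'.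
  have c1 : ((coset D b')^-1 * coset D b = coset D a' * (coset D a)^-1)%g.
    by apply: (mulIg (coset D a)); rewrite mulgKV -mulgA E' mulKg.
  have cbT : coset D b \in Phi' by rewrite -im' imset_f.
  have cb'T : coset D b' \in Phi' by rewrite -im' imset_f.
  have caT : coset D a \in Phi_p by rewrite -imp imset_f.
  have ca'T : coset D a' \in Phi_p by rewrite -imp imset_f.
  have : ((coset D b')^-1 * coset D b)%g \in (Phi' :&: Phi_p)%g.
    by rewrite inE {2}c1 !groupM ?groupV.
  rewrite TI => /set1P bb; move: c1; rewrite bb => /esym/eqP.
  rewrite -eq_mulgV1 => /eqP/(injp _ _ a'T aT) aa.
  move/eqP: bb; rewrite -eq_mulVg1 => /eqP/(inj' _ _ b'T bT) bb.
  by move: E; rewrite aa bb => /mulIg ->.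
have m_im : m @: setX D (setX T' T_p) = [set: gT].
  apply/setP => x; rewrite inE; apply/imsetP.
  have : coset D x \in (Phi' * Phi_p)%g.
    by rewrite PhiE mem_quotient ?inE.
  rewrite -im' -imp => /mulsgP[_ _ /imsetP[b bT ->] /imsetP[a aT ->] xE].
  exists (x * (b * a)^-1, (b, a))%g; last by rewrite /m /= mulgKV.
  rewrite !inE /= bT aT !andbT; apply: (coset_idr (H := D)) => //.
  by rewrite cosM morphV //= cosM -xE mulgV.
rewrite -m_im big_imset //=.
have -> : \sum_(t in setX D (setX T' T_p)) F (m t) =
    \sum_(t in setX D (setX T' T_p)) u t.2.1 * F t.2.2.
  apply: eq_bigr => -[d [b a]]; rewrite !inE /= => /and3P[dD bT aT].
  rewrite /F /m /= !uM (mulchar_der1 u1 uM dD) mul1r -mulrA.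
  do 2 congr (_ * _); apply: eq_bigr => i _.
  by rewrite !fM (addchar_der1 (fM i) dD) fT' // !add0r.
rewrite -sumr_const -mulrA big_distrl /=.
rewrite (eq_bigl (fun t => (t.1 \in D) && (t.2 \in setX T' T_p))); last first.
  by case=> d t; rewrite inE.
rewrite -(pair_big_dep (mem D) (fun _ t => t \in setX T' T_p)
  (fun d t => u t.1 * F t.2)) /=.
apply: eq_bigr => d _; rewrite mul1r big_distrlr /= pair_big_dep /=.
by apply: eq_bigl => -[b a]; rewrite inE.
Qed.

(** On T_p the character u is 1, since a power of p takes each lift into D. The [f i] factor through
    the quotient by D, so the sum can be transported along the isomorphism of Phi_p with row
    vectors. *)
Lemma charprod_sum_abelem p k (phi : {rmorphism 'F_p -> R})
    (Phi_p : {group coset_of [~: [set: gT], [set: gT]]}) (T_p : {set gT}) :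
    let D := [~: [set: gT], [set: gT]]%G in
    p \in [pchar R] -> (p.-group Phi_p)%g ->
    (Phi_p \isog [set: 'rV['F_p]_k])%g ->
    {in T_p &, injective (coset D)} -> coset D @: T_p = Phi_p ->
    \sum_(x in T_p) F x != 0 ->
  (p - 1 %| n)%N /\ (k <= n %/ (p - 1))%N.
Proof.
move=> D pR pPhi isoPhi injp imp.
have nD x : x \in 'N(D)%g.
  by apply: (subsetP (der_norm 1 [set: gT])); rewrite inE.
have fC i x y : coset D x = coset D y -> f i x = f i y.
  move=> xy; rewrite -[x](mulgKV y) fM (addchar_der1 (fM i)) ?add0r //.
  apply: (coset_idr (H := D)) => //.
  by rewrite morphM //= morphV //= xy mulgV.
have uT x : x \in T_p -> u x = 1.
  move=> xT; have [e oe] := p_natP pPhi.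
  apply: (mulchar_pchar (k := e) u1 uM pR); apply: (mulchar_der1 u1 uM).
  apply: (coset_idr (H := D)) => //.
  by rewrite morphX //= -oe expg_cardG // -imp imset_f.
move: isoPhi; rewrite isog_sym => /isogP[g g_inj g_im].
pose f' i v := f i (repr (g v)).
have f'D i : {morph f' i : v w / v + w}.
  move=> v w; rewrite /f' -fM; apply: fC.
  rewrite coset_reprK [RHS](morphM (coset_morphism D)) //= !coset_reprK.
  by rewrite -(morphM g) ?inE.
rewrite (_ : \sum_(x in T_p) F x = \sum_v \prod_(i < n) f' i v).
  exact: sum_prod_additive_rV_neq0.
transitivity (\sum_(x in T_p) \prod_(i < n) f i (repr (coset D x))).
  apply: eq_bigr => x xT; rewrite /F uT // mul1r; apply: eq_bigr => i _.
  by apply: fC; rewrite coset_reprK.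
rewrite -(big_imset (fun c : coset_of D => \prod_(i < n) f i (repr c)) injp) /=.
rewrite imp -g_im morphimEdom big_imset /=; last first.
  by move=> v w _ _; apply: (injmP g_inj); rewrite inE.
by apply: eq_bigl => v; rewrite inE.
Qed.

End CharacterProduct.

(** * Weights evaluated at grouplike and pseudo-primitive elements *)

Section PseudoPrimitiveWeights.
Variables (R : idomainType) (H : hopfAlgType R) (Pi : finSubgroup (weight H)).
Local Notation elt := (finSubgroup_elt Pi).
Local Notation ev gamma := (val (gamma : elt) : weight H).

Lemma ev_mul (gamma nu : elt) x :
  ev (gamma * nu)%g x = conv (ev gamma) (ev nu) x.
Proof. by []. Qed.

Lemma ev_one g : grouplike g -> ev 1%g g = 1.
Proof. by case. Qed.

Lemma ev_grouplike g : grouplike g ->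
  {morph (fun gamma => ev gamma g) : gamma nu / (gamma * nu)%g >-> gamma * nu}.
Proof.
move=> [gD _] gamma nu; rewrite ev_mul /conv gD.
by rewrite (tlift_pure (balanced_conv (weight_scalar _) (weight_scalar _))).
Qed.

Lemma ev_pseudo_primitive g h g' : pseudo_primitive Pi g h g' ->
  exists2 f : elt -> R, {morph f : x y / (x * y)%g >-> x + y} &
    forall gamma, ev gamma h = ev gamma g * f gamma.
Proof.
move=> [gg gg' gE hD]; have gM := ev_grouplike gg; have g1 := ev_one gg.
have gV gamma : ev (gamma^-1)%g g * ev gamma g = 1.
  by rewrite mulrC; apply: mulcharV g1 gM _.
exists (fun gamma => ev (gamma^-1)%g g * ev gamma h); last first.
  by move=> gamma; rewrite mulrCA mulrA gV mul1r.
move=> gamma nu; rewrite [ev (gamma * nu)%g h]ev_mul /conv hD.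
have b := balanced_conv (weight_scalar (val gamma)) (weight_scalar (val nu)).
rewrite (tliftD b) !(tlift_pure b).
(* Pseudo-primitivity with respect to Pi enters here: nu(g') becomes nu(g). *)
rewrite -(gE _ (valP nu)).
rewrite invgM gM (mulrC (ev (nu^-1)%g g) (ev (gamma^-1)%g g)).
by rewrite mulrDr !(mulrACA _ (ev (nu^-1)%g g)) !gV mul1r mulr1 addrC.
Qed.

Lemma ev_prod_pseudo_primitive n (h g g' : 'I_n -> H) :
    (forall i, pseudo_primitive Pi (g i) (h i) (g' i)) ->
  exists f : 'I_n -> elt -> R,
    (forall i, {morph f i : x y / (x * y)%g >-> x + y}) /\
    forall gamma, ev gamma (\prod_(i < n) h i) =
      ev gamma (\prod_(i < n) g i) * \prod_(i < n) f i gamma.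
Proof.
move=> ph.
have /choice[f fP] : forall i, exists f : elt -> R,
    {morph f : x y / (x * y)%g >-> x + y} /\
    forall gamma, ev gamma (h i) = ev gamma (g i) * f gamma.
  by move=> i; have [f] := ev_pseudo_primitive (ph i); exists f.
exists f; split=> [i|gamma]; first by case: (fP i).
rewrite !rmorph_prod -big_split; apply: eq_bigr => i _ /=.
by case: (fP i) => _ ->.
Qed.

Lemma grouplike_prod n (g : 'I_n -> H) :
  (forall i, grouplike (g i)) -> grouplike (\prod_(i < n) g i).
Proof.
move=> gg; elim/big_ind: _ => // [|x y [xD x1] [yD y1]]; split.
- exact: rmorph1.
- exact: rmorph1.
- by rewrite rmorphM /= xD yD pureM.
- by rewrite rmorphM /= x1 y1 mulr1.
Qed.

End PseudoPrimitiveWeights.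

(** * The Hopf algebra of functions on a finite group *)

Lemma tlift_sum (R : comNzRingType) (M N : lmodType R) (W : zmodType)
    (f : M -> N -> W) (I : finType) (x : I -> M) (y : I -> N) : balanced f ->
  tlift f (\sum_i x i \otimes y i) = \sum_i f (x i) (y i).
Proof.
move=> bf; rewrite (big_morph _ (tliftD bf) (tlift0 bf)).
by apply: eq_bigr => i _; rewrite tlift_pure.
Qed.

Lemma pure0l (R : comNzRingType) (M N : lmodType R) (y : N) :
  (0 : M) \otimes y = 0.
Proof. by apply: (addrI ((0 : M) \otimes y)); rewrite -pureDl !addr0. Qed.

Lemma pure_suml (R : comNzRingType) (M N : lmodType R) (I : finType)
    (x : I -> M) (y : N) : (\sum_i x i) \otimes y = \sum_i x i \otimes y.
Proof. exact: (big_morph _ (fun u v => pureDl u v y) (pure0l _ y)). Qed.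

Lemma pure0r (R : comNzRingType) (M N : lmodType R) (x : M) :
  x \otimes (0 : N) = 0.
Proof. by apply: (addrI (x \otimes (0 : N))); rewrite -pureDr !addr0. Qed.

Lemma pure_sumr (R : comNzRingType) (M N : lmodType R) (I : finType)
    (x : M) (y : I -> N) : x \otimes (\sum_i y i) = \sum_i x \otimes y i.
Proof. exact: (big_morph _ (fun u v => pureDr x u v) (pure0r _ x)). Qed.

Definition fun_alg (gT : finGroupType) (R : comNzRingType) : Type :=
  {ffun gT -> R^o}.

Section FunctionAlgebra.
Variables (gT : finGroupType) (R : comNzRingType).
Local Notation H := (fun_alg gT R).
Implicit Types (f h : H) (a b : gT).

HB.instance Definition _ := GRing.Lmodule.on H.
HB.instance Definition _ := GRing.Zmodule_isNzRing.Build H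
  (@ffun_mulA gT R) (@ffun_mul_1l gT R) (@ffun_mul_1r gT R)
  (@ffun_mul_addl gT R) (@ffun_mul_addr gT R) (@ffun1_nonzero gT R 1%g).

Lemma fun_algM f h a : (f * h) a = f a * h a.
Proof. exact: ffunE. Qed.
Lemma fun_alg1 a : (1 : H) a = 1.
Proof. exact: ffunE. Qed.
Lemma fun_algD f h a : (f + h) a = f a + h a.
Proof. exact: ffunE. Qed.
Lemma fun_algZ c f a : (c *: f) a = c * f a.
Proof. exact: ffunE. Qed.

Let E := (fun_algM, fun_algD, fun_alg1, fun_algZ).

Lemma fun_alg_scaleAl c f h : c *: (f * h) = c *: f * h.
Proof. by apply/ffunP => a; rewrite !E mulrA. Qed.
HB.instance Definition _ := GRing.Lmodule_isLalgebra.Build R H fun_alg_scaleAl.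

Lemma fun_alg_scaleAr c f h : c *: (f * h) = f * (c *: h).
Proof. by apply/ffunP => a; rewrite !E mulrCA. Qed.
HB.instance Definition _ := GRing.Lalgebra_isAlgebra.Build R H fun_alg_scaleAr.

Definition fun_delta a : H := [ffun b => (b == a)%:R].
Definition fun_shift a h : H := [ffun b => h (a * b)%g].

Lemma fun_sumE (I : finType) (F : I -> H) a : (\sum_i F i) a = \sum_i F i a.
Proof. by rewrite sum_ffunE. Qed.

Lemma sum_deltaE h : \sum_a h a *: fun_delta a = h.
Proof.
apply/ffunP => b; rewrite fun_sumE (bigD1 b) //= E ffunE eqxx mulr1.
rewrite big1 ?addr0 // => a ab.
by rewrite E ffunE eq_sym (negPf ab) mulr0.
Qed.

Lemma sum_delta : \sum_a fun_delta a = 1.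
Proof.
rewrite -[RHS]sum_deltaE; apply: eq_bigr => a _.
by rewrite fun_alg1 scale1r.
Qed.

Lemma fun_shift_linear a : linear (fun_shift a).
Proof. by move=> c f h; apply/ffunP => b; rewrite !(ffunE, E). Qed.
HB.instance Definition _ a :=
  GRing.isLinear.Build R H H *:%R (fun_shift a) (fun_shift_linear a).

(** Once the tensor square is identified with functions of two variables, this is the function (a,
    b) |-> h (a * b). *)
Definition fun_comul h : tensor H H := \sum_a fun_delta a \otimes fun_shift a h.
Definition fun_counit h : R := h 1%g.
Definition fun_antipode h : H := [ffun a => h (a^-1)%g].

Lemma fun_comul_linear : linear fun_comul.
Proof.
move=> c f h; rewrite /fun_comul scaler_sumr -big_split; apply: eq_bigr => a _.
by rewrite linearP pureDr pureZr.
Qed.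

Lemma delta_mul a b :
  fun_delta a * fun_delta b = if a == b then fun_delta a else 0.
Proof.
apply/ffunP => x; rewrite !(E, ffunE) -natrM mulnb.
case: (eqVneq a b) => [<-|ab]; first by rewrite andbb ffunE.
rewrite [RHS]ffunE; case: eqP => // ->.
by rewrite (negPf ab).
Qed.

Lemma fun_comul_monoid_morphism : monoid_morphism fun_comul.
Proof.
split=> [|f h]; rewrite /fun_comul.
  transitivity (\sum_a fun_delta a \otimes (1 : H)); last first.
    by rewrite -pure_suml sum_delta.
  apply: eq_bigr => a _; congr (_ \otimes _).
  by apply/ffunP => b; rewrite !ffunE.
rewrite big_distrlr /=; apply: eq_bigr => a _.
rewrite (bigD1 a) //= pureM delta_mul eqxx big1 ?addr0 => [|b ba].
  by congr (_ \otimes _); apply/ffunP => b; rewrite !(ffunE, E).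
rewrite pureM delta_mul eq_sym (negPf ba).
by rewrite pure0l.
Qed.

Lemma tlift_comul (W : zmodType) (B : H -> H -> W) h : balanced B ->
  tlift B (fun_comul h) = \sum_a B (fun_delta a) (fun_shift a h).
Proof. exact: tlift_sum. Qed.

Lemma fun_shift_delta a b : fun_shift a (fun_delta b) = fun_delta (a^-1 * b)%g.
Proof. by apply/ffunP => x; rewrite !ffunE (can2_eq (mulKg a) (mulKVg a)). Qed.

Lemma fun_shiftM a b h : fun_shift b (fun_shift a h) = fun_shift (a * b)%g h.
Proof. by apply/ffunP => x; rewrite !ffunE mulgA. Qed.

Lemma fun_comulA h :
  tassoc (tmap fun_comul idfun (fun_comul h)) =
  tmap idfun fun_comul (fun_comul h).
Proof.
have b1 : balanced (fun f g : H => fun_comul f \otimes g).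
  split=> [f f' g|f g g'|c f g]; rewrite ?pureDr //.
    by rewrite -pureDl -[f]scale1r fun_comul_linear !scale1r.
  by rewrite (scalable_linear fun_comul_linear) pureZl pureZr.
have b2 : balanced (fun f g : H => f \otimes fun_comul g).
  split=> [f f' g|f g g'|c f g]; rewrite ?pureDl //.
    by rewrite -pureDr -[g]scale1r fun_comul_linear !scale1r.
  by rewrite (scalable_linear fun_comul_linear) pureZl pureZr.
have b3 (z : H) : balanced (fun x y : H => x \otimes (y \otimes z)).
  by split=> *; rewrite ?pureDl ?pureDr // ?pureZl ?pureZr.
have b4 : balanced (fun (u : tensor H H) (z : H) =>
    tlift (fun x y => x \otimes (y \otimes z)) u).
  split=> [u u' z|u z z'|a u z]; first by rewrite tliftD.
    elim/tclassW: u => s; rewrite !tlift_class // -big_split.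
    by apply: eq_bigr => p _; rewrite !pureDr.
  move: u; apply: tensor_ext => [u v|u v|x y]; rewrite ?scalerDr ?tliftD //.
  by rewrite -pureZl !tlift_pure // pureZl !pureZr.
rewrite /tmap !tlift_comul // /tassoc tlift_sum //.
transitivity (\sum_a \sum_b fun_delta b \otimes
    (fun_delta (b^-1 * a)%g \otimes fun_shift a h)).
  apply: eq_bigr => a _; rewrite tlift_comul //; apply: eq_bigr => b _.
  by rewrite fun_shift_delta.
rewrite exchange_big; apply: eq_bigr => b _ /=.
(* With b * a for a, both sides represent the function (b, a, x) |-> h (b * a * x). *)
rewrite (reindex_inj (mulgI b)) /= pure_sumr; apply: eq_bigr => a _.
by rewrite mulKg fun_shiftM.
Qed.

Lemma fun_counit_linear : scalar fun_counit.
Proof. by move=> c f h; rewrite /fun_counit !E. Qed.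

Lemma fun_counit_monoid_morphism : monoid_morphism fun_counit.
Proof. by split=> [|f h]; rewrite /fun_counit E. Qed.

Lemma fun_antipode_linear : linear fun_antipode.
Proof. by move=> c f h; apply/ffunP => b; rewrite !(ffunE, E). Qed.
HB.instance Definition _ :=
  GRing.isLinear.Build R H H *:%R fun_antipode fun_antipode_linear.

Lemma fun_counitl h :
  tlift (fun x y => fun_counit x *: y) (fun_comul h) = h.
Proof.
rewrite tlift_comul.
  rewrite (bigD1 1%g) //= big1 ?addr0 => [|a a1]; rewrite /fun_counit ffunE.
    by rewrite eqxx scale1r; apply/ffunP => x; rewrite ffunE mul1g.
  by rewrite eq_sym (negPf a1) scale0r.
split=> *; rewrite /fun_counit ?E ?scalerDr ?scalerDl //.
by rewrite scalerA mulrC.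
Qed.

Lemma fun_counitr h :
  tlift (fun x y => fun_counit y *: x) (fun_comul h) = h.
Proof.
rewrite tlift_comul.
  rewrite -[RHS]sum_deltaE; apply: eq_bigr => a _.
  by rewrite /fun_counit ffunE mulg1.
split=> *; rewrite /fun_counit ?E ?scalerDr ?scalerDl //.
by rewrite scalerA mulrC.
Qed.

Lemma fun_antipodel h :
  tlift (fun x y => fun_antipode x * y) (fun_comul h) = (fun_counit h)%:A.
Proof.
rewrite tlift_comul.
  apply/ffunP => x; rewrite fun_sumE !E mulr1 (bigD1 x^-1%g) //= !(E, ffunE).
  rewrite eqxx mul1r mulVg big1 ?addr0 // => a ax.
  by rewrite !(E, ffunE) eq_sym (negPf ax) mul0r.
by split=> *; rewrite ?linearD ?mulrDr ?mulrDl // linearZ -scalerAl scalerAr.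
Qed.

Lemma fun_antipoder h :
  tlift (fun x y => x * fun_antipode y) (fun_comul h) = (fun_counit h)%:A.
Proof.
rewrite tlift_comul.
  apply/ffunP => x; rewrite fun_sumE !E mulr1 (bigD1 x) //= !(E, ffunE).
  rewrite eqxx mul1r mulgV big1 ?addr0 // => a ax.
  by rewrite !(E, ffunE) eq_sym (negPf ax) mul0r.
by split=> *; rewrite ?linearD ?mulrDr ?mulrDl // linearZ -scalerAl scalerAr.
Qed.

HB.instance Definition _ := isHopf.Build R H
  fun_comul_linear fun_comul_monoid_morphism
  fun_counit_linear fun_counit_monoid_morphism fun_antipode_linear
  fun_comulA fun_counitl fun_counitr fun_antipodel fun_antipoder.

Definition fun_eval a h : R := h a.

Lemma fun_eval_linear a : scalar (fun_eval a).
Proof. by move=> c f h; rewrite /fun_eval !E. Qed.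
Lemma fun_eval_monoid_morphism a : monoid_morphism (fun_eval a).
Proof. by split=> [|f h]; rewrite /fun_eval E. Qed.
HB.instance Definition _ a :=
  GRing.isLinear.Build R H R *%R (fun_eval a) (fun_eval_linear a).
HB.instance Definition _ a :=
  GRing.isMonoidMorphism.Build H R (fun_eval a) (fun_eval_monoid_morphism a).

Definition eval_weight a : weight H := (fun_eval a : {lrmorphism H -> R | *%R}).

Lemma eval_weightM : {morph eval_weight : a b / (a * b)%g}.
Proof.
move=> a b; apply: weightP => h /=; rewrite -[RHS]/(conv _ _ h) /conv.
have b2 := balanced_conv (weight_scalar (eval_weight a))
  (weight_scalar (eval_weight b)).
rewrite (tlift_comul _ b2).
rewrite (bigD1 a) //= /fun_eval !ffunE eqxx mul1r big1 ?addr0 // => c ca.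
by rewrite ffunE eq_sym (negPf ca) mul0r.
Qed.

Lemma eval_weight1 : eval_weight 1%g = 1%g.
Proof. exact: weightP. Qed.

Lemma eval_weightV a : eval_weight (a^-1)%g = (eval_weight a)^-1%g.
Proof.
apply: (mulgI (eval_weight a)).
by rewrite -eval_weightM !mulgV eval_weight1.
Qed.

Lemma eval_weight_inj : injective eval_weight.
Proof.
move=> a b ab; have : eval_weight a (fun_delta a) = eval_weight b (fun_delta a).
  by rewrite ab.
rewrite /= /fun_eval !ffunE eqxx; case: eqP => // _ /eqP.
by rewrite oner_eq0.
Qed.

Definition eval_set : {fset weight H} := [fset eval_weight a | a in gT]%fset.

Lemma eval_set_closed : group_closed (mem eval_set).
Proof.
split=> [|x y]; first by apply/imfsetP; exists 1%g; rewrite // eval_weight1.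
move=> /imfsetP[a _ ->] /imfsetP[b _ ->]; apply/imfsetP.
by exists (a * b^-1)%g; rewrite // eval_weightM eval_weightV.
Qed.

Definition eval_group := FinSubgroup eval_set_closed.

Lemma eval_group_mem a : eval_weight a \in eval_set.
Proof. by apply/imfsetP; exists a. Qed.

Definition eval_elt a : finSubgroup_elt eval_group :=
  [` eval_group_mem a]%fset.

Lemma eval_elt_bij : bijective eval_elt.
Proof.
apply: inj_card_bij => [a b /(congr1 val) /eval_weight_inj //|].
rewrite -!cardsT; apply: leq_trans (leq_imset_card eval_elt _).
apply/subset_leq_card/subsetP => x _; apply/imsetP.
have /imfsetP[a _ xa] := valP x.
by exists a; rewrite ?inE //; apply: val_inj.
Qed.

Lemma grouplike1 : grouplike (1 : H).
Proof. by split; [exact: rmorph1 | exact: rmorph1]. Qed.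

(** Additivity says that the shift of f by a is f a *: 1 + f; summing against [fun_delta a] recovers
    f in one term and 1 in the other. *)
Lemma additive_primitive (f : H) (P : finSubgroup (weight H)) :
  (forall a b, f (a * b)%g = f a + f b) -> pseudo_primitive P 1 f 1.
Proof.
move=> fM; split=> //; try exact: grouplike1.
rewrite -[comul f]/(fun_comul f) /fun_comul.
transitivity (\sum_a (f a *: fun_delta a \otimes 1 + fun_delta a \otimes f)).
  apply: eq_bigr => a _; rewrite pureZl -pureZr -pureDr; congr (_ \otimes _).
  by apply/ffunP => b; rewrite !(E, ffunE) mulr1 fM.
by rewrite big_split /= -!pure_suml sum_deltaE sum_delta addrC.
Qed.

End FunctionAlgebra.

Theorem theorem1p2 :
  (forall (n : nat) (R : idomainType) (H : hopfAlgType R)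
     (Pi : finSubgroup (weight H)) (h g g' : 'I_n -> H),
   (0 < n)%N ->
   (forall i : 'I_n, pseudo_primitive Pi (g i) (h i) (g' i)) ->
   let hh := \prod_(i < n) h i in
   let gg := \prod_(i < n) g i in
   let WPi := [set: finSubgroup_elt Pi] in
   let Phi := abelianization Pi in
   [/\ (* (1) *)
       [pchar R] =i pred0 \/
         (exists2 p : nat, p \in [pchar R] & ~~ (p %| #|WPi|)%N) ->
       weight_sum WPi hh = 0,
       (* (2) *)
       forall (p : nat) (Pi_p : {group finSubgroup_elt Pi}),
         p \in [pchar R] -> (p %| #|WPi|)%N -> (p.-Sylow(WPi) Pi_p)%g ->
         (forall m : nat, (0 < m)%N -> ~~ (Pi_p \isog [set: 'rV['F_p]_m])%g) ->
         weight_sum WPi hh = 0,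
       (* (3) *)
       forall (p k : nat) (Phi_p Phi' : {group coset_of (derived Pi)})
              (T_p T' : {set finSubgroup_elt Pi}),
         p \in [pchar R] -> (p %| #|WPi|)%N ->
         (p.-Sylow(Phi) Phi_p)%g -> (Phi_p \isog [set: 'rV['F_p]_k])%g ->
         (p^'.-Hall(Phi) Phi')%g ->
         is_lift Phi_p T_p -> is_lift Phi' T' ->
         weight_sum WPi hh =
           #|derived Pi|%:R * weight_sum T' gg * weight_sum T_p hh
     & (* (4), first part *)
       forall (p k : nat) (Phi_p : {group coset_of (derived Pi)})
              (T_p : {set finSubgroup_elt Pi}),
         p \in [pchar R] -> (p %| #|WPi|)%N ->
         (p.-Sylow(Phi) Phi_p)%g -> (Phi_p \isog [set: 'rV['F_p]_k])%g ->
         is_lift Phi_p T_p ->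
         weight_sum T_p hh != 0 ->
         (p - 1 %| n)%N /\ (k <= n %/ (p - 1))%N])
  /\
  (* (4), second part *)
  (forall (R : idomainType) (p : nat) (r : R), p \in [pchar R] ->
   exists (n : nat) (H : hopfAlgType R) (Pi : finSubgroup (weight H))
          (h g g' : 'I_n -> H) (k : nat)
          (Phi_p : {group coset_of (derived Pi)}),
   [/\ (0 < n)%N,
       forall i : 'I_n, pseudo_primitive Pi (g i) (h i) (g' i),
       (p %| #|[set: finSubgroup_elt Pi]|)%N,
       (p.-Sylow(abelianization Pi) Phi_p)%g /\ (Phi_p \isog [set: 'rV['F_p]_k])%g
     & forall T_p : {set finSubgroup_elt Pi}, is_lift Phi_p T_p ->
         weight_sum T_p (\prod_(i < n) h i) = r]).
Proof.
split.
  move=> n R H Pi h g g' n_gt0 ph hh gg WPi Phi.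
  have [f [fM hhE]] := ev_prod_pseudo_primitive ph.
  have ggG : grouplike gg by apply: grouplike_prod => i; case: (ph i).
  have u1 := ev_one Pi ggG; have uM := ev_grouplike ggG (Pi := Pi).
  have sumE T : weight_sum T hh =
      \sum_(x in T) (val (x : finSubgroup_elt Pi) : weight H) gg *
        \prod_(i < n) f i x.
    by apply: eq_bigr => x _; rewrite hhE.
  split.
  - move=> pR; rewrite sumE; apply: charprod_sum_pchar' => //.
    (* Either alternative says that the order of Pi is nonzero in R. *)
    case: pR => [/pcharf0P ->|[p pR]]; last by rewrite (dvdn_pcharf pR).
    by rewrite -lt0n cardG_gt0.
  - by move=> p P pR pPi sP nab; rewrite sumE; apply: charprod_sum_Sylow nab.
  - move=> p k Phi_p Phi' T_p T' pR _ sylP _ hallP' [injp imp] [inj' im'].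
    by rewrite !sumE; apply: (charprod_sum_split u1 uM fM pR sylP hallP').
  - move=> p k Phi_p T_p pR _ sylP isoP [injp imp]; rewrite sumE.
    exact: (charprod_sum_abelem u1 uM fM (Fp_morph pR) pR
      (pHall_pgroup sylP) isoP).
move=> R p r pR; have p_pr := pcharf_prime pR.
have p1_gt0 : (0 < p - 1)%N by rewrite subn_gt0 prime_gt1.
(* The group structure on 'F_p is the additive one. Pi has order p, so it is abelian and its
   abelianization is its own p-Sylow subgroup, of rank k = 1. *)
pose gT := [the finGroupType of 'F_p]; pose Pi := eval_group gT R.
have oPi : #|[set: finSubgroup_elt Pi]| = p.
  by rewrite cardsT -(bij_eq_card (eval_elt_bij gT R)) card_Fp.
have D1 : derived Pi :=: 1%g.
  apply/commG1P; apply: cyclic_abelian; apply: prime_cyclic.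
  by rewrite oPi.
have nD x : x \in 'N(derived Pi)%g by rewrite D1 norm1 inE.
have oPhi : #|abelianization Pi| = p.
  by rewrite card_quotient ?D1 ?norms1 // indexg1.
have coset_inj : injective (coset (derived Pi)).
  move=> x y xy; apply/eqP; rewrite eq_mulgV1.
  have : (x * y^-1)%g \in derived Pi; last by rewrite D1 inE.
  by apply: coset_idr => //; rewrite morphM //= morphV //= xy mulgV.
(* One of the p - 1 factors carries - r, so the product of the h i is x |-> - r * x ^+ (p - 1). *)
pose c (i : 'I_(p - 1)) : R := if i == Ordinal p1_gt0 then - r else 1.
pose h i : fun_alg gT R := [ffun x => c i * Fp_morph pR x].
exists (p - 1)%N, (fun_alg gT R : hopfAlgType R), Pi, h.
exists (fun=> 1), (fun=> 1), 1%N.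
exists (abelianization Pi); split=> //.
- move=> i; apply: additive_primitive => x y.
  by rewrite !ffunE -mulrDr -rmorphD.
- by rewrite oPi.
- split.
    by rewrite pHallE subxx /= part_pnat_id // oPhi pnat_id.
  have oV : #|[set: 'rV['F_p]_1]| = p by rewrite cardsT card_mx card_Fp.
  have cV : cyclic [set: 'rV['F_p]_1] by rewrite prime_cyclic ?oV.
  have cPhi : cyclic (abelianization Pi) by rewrite prime_cyclic ?oPhi.
  rewrite (isog_cyclic_card _ cPhi); apply/andP; split; first exact: cV.
  by apply/eqP; rewrite [LHS]oV [RHS]oPhi.
move=> T_p [_ imT].
(* T_p surjects onto a set of p elements and Pi has only p. *)
have -> : T_p = [set: finSubgroup_elt Pi].
  apply/eqP; rewrite eqEcard subsetT oPi -oPhi -imT.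
  exact: leq_imset_card.
rewrite /weight_sum (reindex (@eval_elt gT R)) /=; last first.
  exact: onW_bij (eval_elt_bij gT R).
rewrite (eq_bigl predT) => [|x]; last by rewrite inE.
rewrite (eq_bigr (fun x : 'F_p => - r * Fp_morph pR x ^+ (p - 1))); last first.
  move=> x _; rewrite rmorph_prod /= /fun_eval.
  under eq_bigr do rewrite ffunE.
  rewrite big_split /= prodr_const card_ord; congr (_ * _).
  rewrite (bigD1 (Ordinal p1_gt0)) //= big1 ?mulr1 /c ?eqxx // => i i0.
  by rewrite (negPf i0).
(* The term at 0 vanishes as p - 1 > 0; the other p - 1 terms are 1, so the power sum is p - 1 = -1
   in R and the total is r. *)
rewrite -mulr_sumr (bigD1 (0 : 'F_p)) //= rmorph0 expr0n eqn0Ngt p1_gt0 add0r.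
rewrite (eq_bigr (fun=> 1)) => [|x x0]; last first.
  by rewrite -rmorphXn expFp_p1 // rmorph1.
rewrite sumr_const (_ : #|_| = (p - 1)%N); last first.
  by rewrite cardC1 card_Fp // subn1.
by rewrite natrB ?prime_gt0 // pcharf0 // sub0r mulrNN mulr1.
Qed.
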